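(* Let $n\ge 1$ and $k\ge 1$ be integers and let $\lambda=(\lambda_1\ge\dots\ge\lambda_n\ge 0)$ be a partition with at most $n$ parts. Let $g_\lambda^{n,k}$ be the coefficient of the Schur polynomial $s_\lambda(z_1,\dots,z_n)$ in the expansion of $V(z_1,\dots,z_n)^{2k}=\prod_{1\le i<j\le n}(z_i-z_j)^{2k}$ in the basis of Schur polynomials in $n$ variables. Then $$g_\lambda^{n,k}=(-1)^{\frac{n(n-1)}{2}}\,\mathfrak D_{\lambda,\underbrace{[0^n],\dots,[0^n]}_{2k+1\text{ times}}},$$ where $[0^n]=[0,\dots,0]\in\mathbb Z^n$.
   Context: For an even integer $2p$ and a tensor $\mathrm M=(M_{i_1,\dots,i_{2p}})_{1\le i_1,\dots,i_{2p}\le n}$, the hyperdeterminant is $$\mathrm{Det}(\mathrm M)=\frac1{n!}\sum_{\sigma_1,\dots,\sigma_{2p}\in\mathfrak S_n}\mathrm{sign}(\sigma_1\cdots\sigma_{2p})\prod_{i=1}^n M_{\sigma_1(i),\dots,\sigma_{2p}(i)},$$ where $\mathfrak S_n$ is the symmetric group. A vector $\lambda=[\lambda_1,\dots,\lambda_n]\in\mathbb Z^n$ is called decreasing if $\lambda_1\ge\dots\ge\lambda_n$. For $2p$ decreasing vectors $\lambda^{(1)},\dots,\lambda^{(2p)}\in\mathbb Z^n$, define the tensor with $2p$ indices $$\Delta_{\lambda^{(1)},\dots,\lambda^{(2p)}}=\left(\delta_{\lambda^{(1)}_{n-i_1+1}+\dots+\lambda^{(2p)}_{n-i_{2p}+1}+i_1+\dots+i_{2p},\,(2p-1)n+1}\right)_{1\le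 i_1,\dots,i_{2p}\le n}$$ ($\delta$ is the Kronecker delta) and $\mathfrak D_{\lambda^{(1)},\dots,\lambda^{(2p)}}=\mathrm{Det}(\Delta_{\lambda^{(1)},\dots,\lambda^{(2p)}})$. In the claim this is used with $2p=2k+2$. The Schur polynomial is $s_\lambda(z_1,\dots,z_n)=\det(z_i^{\lambda_{n-j+1}+j-1})_{1\le i,j\le n}/\det(z_i^{j-1})_{1\le i,j\le n}$. *)

(* Defs.v *)
From HB Require Import structures.
From mathcomp Require Import all_boot all_order all_fingroup all_algebra.
From mathcomp Require Import finmap mpoly.

Set Implicit Arguments.
Unset Strict Implicit.
Unset Printing Implicit Defensive.

Import GRing.Theory.
Local Open Scope ring_scope.

(* A tensor with [p.*2] indices is a function of its multi-index.  The index  *)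
(* ranges are zero-based: an informal index i in {1, .., n} is i.+1 here.     *)
Definition hyperdet (F : fieldType) (n p : nat)
    (M : {ffun 'I_(p.*2) -> 'I_n} -> F) : F :=
  (n`!)%:R^-1 *
  \sum_(s : {ffun 'I_(p.*2) -> 'S_n})
     (-1) ^+ odd_perm (\prod_(l < p.*2) s l)%g *
     \prod_(i < n) M [ffun l => s l i].

(* Because of the zero-based indices, the entry of index n - i + 1 of a       *)
(* vector is [v (rev_ord i)], and each summand i_l becomes [(i l).+1].        *)
Definition delta_tensor (F : fieldType) (n p : nat)
    (v : (p.*2).-tuple {ffun 'I_n -> int}) (i : {ffun 'I_(p.*2) -> 'I_n}) : F :=
  (\sum_(l < p.*2) (tnth v l (rev_ord (i l)) + (i l).+1%:Z)
     == ((p.*2 - 1) * n + 1)%N%:Z)%:R.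

Definition hyperdet_delta (F : fieldType) (n p : nat)
    (v : (p.*2).-tuple {ffun 'I_n -> int}) : F :=
  hyperdet (@delta_tensor F n p v).

Definition decreasing (n : nat) (v : {ffun 'I_n -> int}) : bool :=
  [forall i : 'I_n, forall j : 'I_n, (i <= j)%N ==> (v j <= v i)].

(* Partitions with at most n parts, padded with zeros to length n. *)
Record partition_le (n : nat) := PartitionLe {
  part_vec :> {ffun 'I_n -> int};
  part_vecP : decreasing part_vec && [forall i, 0 <= part_vec i] }.

HB.instance Definition _ n := [isSub for @part_vec n].
HB.instance Definition _ n := [Choice of partition_le n by <:].

(* The quotient of alternants, taken in the field of rational functions.      *)
Definition schur (F : fieldType) (n : nat) (v : {ffun 'I_n -> int}) :
    {fraction {mpoly F[n]}} :=
  let z (i : 'I_n) := tofrac ('X_i : {mpoly F[n]}) in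
  \det (\matrix_(i < n, j < n) z i ^ (v (rev_ord j) + j%:Z))
  / \det (\matrix_(i < n, j < n) z i ^+ j).

Definition vandermonde (F : fieldType) (n : nat) : {mpoly F[n]} :=
  \prod_(i < n) \prod_(j < n | (i < j)%N) ('X_i - 'X_j).

(* [g] is the finitely supported family of coefficients of [f] in the Schur   *)
(* polynomials in n variables.                                                *)
Definition schur_expansion (F : fieldType) (n : nat) (f : {mpoly F[n]})
    (g : {fsfun partition_le n -> F with 0}) : Prop :=
  tofrac f =
    \sum_(mu <- finsupp g) tofrac ((g mu)%:MP : {mpoly F[n]}) * schur F mu.

(* Main.v *)
(** Multiplying by the Vandermonde alternant [a_delta] turns the expansion into
    [a_delta ^ (2k+1) = \sum_mu g_mu a_(mu+delta)].  An alternating polynomial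
    is determined by its coefficients at the strictly increasing exponents
    [mu + delta], and [a_(mu+delta)] has coefficient [delta_(mu,nu)] at
    [nu + delta]; hence [g_mu] is the coefficient of [a_delta ^ (2k+1)] at
    [mu + delta], a signed count of the tuples [(u_1, .., u_(2k+1))] of
    permutations with [\sum_l u_l i = (mu + delta)_i] for all [i].  In the
    hyperdeterminant, writing [s_0 = t] and [s_l = w0 u_l t], with [w0] the
    reversal, turns each summand into such a signed tuple times [sgn w0],
    independently of [t]; the sum over [t] cancels [1 / n!]. *)
Require Import Defs.
From mathcomp Require Import all_boot all_order all_fingroup all_algebra.
From mathcomp Require Import finmap mpoly zify.

Set Implicit Arguments.
Unset Strict Implicit.
Unset Printing Implicit Defensive.

Import GRing.Theory.
Local Open Scope ring_scope.

(** * Strictly increasing exponents and partitions *)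

Definition increasing (n : nat) (f : 'I_n -> nat) : Prop :=
  forall i j : 'I_n, (i < j)%N -> (f i < f j)%N.

(** Consecutive values differ by at least one, so subtracting the index leaves a weakly increasing
    sequence; the additive form avoids truncated subtraction. *)
Lemma increasing_gap (n : nat) (f : 'I_n -> nat) (i j : 'I_n) :
  increasing f -> (i <= j)%N -> (f i + j <= f j + i)%N.
Proof.
move=> f_inc; case: j => j; elim: j => [|j IHj] ltjn /= leij.
  by have -> : i = Ordinal ltjn by apply/val_inj => /=; lia.
have [eqij|ltij] := eqVneq (i : nat) j.+1.
  by have -> : i = Ordinal ltjn by apply/val_inj.
have := IHj (ltnW ltjn) ltac:(move: ltij leij => /=; lia).
have /= := f_inc (Ordinal (ltnW ltjn)) (Ordinal ltjn) (ltnSn _).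
by lia.
Qed.

Lemma increasing_ge (n : nat) (f : 'I_n -> nat) (i : 'I_n) :
  increasing f -> (i <= f i)%N.
Proof.
case: n f i => [|n] f i f_inc; first by case: i.
by have := increasing_gap f_inc (leq0n i : (@ord0 n <= i)%N); rewrite /=; lia.
Qed.

(** The inverse of [s] is increasing too, so [increasing_ge] bounds [s i] from both sides. *)
Lemma increasing_perm_id (n : nat) (s : 'S_n) :
  increasing (fun i => s i) -> s = 1%g.
Proof.
move=> s_inc; have sV_inc : increasing (fun i => s^-1%g i).
  move=> i j ltij; case: ltngtP => // [lt|eq].
    by have := s_inc _ _ lt; rewrite !permKV ltnNge ltnW.
  by move/val_inj/perm_inj: eq ltij => ->; rewrite ltnn.
apply/permP => i; rewrite perm1; apply/val_inj/eqP; rewrite eqn_leq.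
rewrite (increasing_ge i s_inc) andbT.
by have := increasing_ge (s i) sV_inc; rewrite permK.
Qed.

Lemma increasing_comp_perm (n : nat) (f : 'I_n -> nat) (s : 'S_n) :
  increasing f -> increasing (f \o s) -> s = 1%g.
Proof.
move=> f_inc fs_inc; apply: increasing_perm_id => i j ltij.
have /= := fs_inc _ _ ltij; case: (ltngtP (s i) (s j)) => // [lt|eq].
  by have := f_inc _ _ lt; lia.
by rewrite (val_inj eq) ltnn.
Qed.

(** Sorting the values of [f] provides the permutation; injectivity makes the sorted order
    strict. *)
Lemma perm_increasing (n : nat) (f : 'I_n -> nat) :
  injective f -> exists s : 'S_n, increasing (f \o s).
Proof.
move=> f_inj; pose t := [tuple f i | i < n].
have /tuple_permP[s def_s] : perm_eq (sort leq t) t by rewrite perm_sort.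
exists s => i j ltij /=.
have : sorted ltn (sort leq t).
  rewrite ltn_sorted_uniq_leq sort_uniq sort_sorted ?andbT; last exact: leq_total.
  by rewrite map_inj_uniq ?enum_uniq.
have nthE (k : 'I_n) : nth 0%N (sort leq t) k = f (s k).
  by rewrite def_s -tnth_nth !tnth_mktuple.
rewrite -!nthE => /(sorted_ltn_nth ltn_trans 0%N); apply => //;
  by rewrite inE size_sort size_tuple.
Qed.

(** The exponent mu + delta, with the parts reversed so that it increases. The absolute value only
    casts to [nat], since parts are nonnegative. *)
Definition stair (n : nat) (mu : partition_le n) : 'X_{1..n} :=
  [multinom (`|mu (rev_ord i)| + i)%N | i < n].

Lemma partition_ge0 (n : nat) (mu : partition_le n) i : 0 <= mu i.
Proof. by have /andP[_ /forallP] := part_vecP mu. Qed.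

Lemma partition_le_anti (n : nat) (mu : partition_le n) (i j : 'I_n) :
  (i <= j)%N -> mu j <= mu i.
Proof.
by have /andP[/forallP/(_ i)/forallP/(_ j)/implyP] := part_vecP mu.
Qed.

Lemma stair_increasing (n : nat) (mu : partition_le n) : increasing (stair mu).
Proof.
move=> i j ltij; rewrite !mnmE.
have : (rev_ord j <= rev_ord i)%N by rewrite /=; lia.
move=> /(partition_le_anti mu).
by have := partition_ge0 mu (rev_ord i); lia.
Qed.

Lemma stair_inj (n : nat) : injective (@stair n).
Proof.
move=> mu nu /mnmP eq_st; apply/val_inj/ffunP => i /=.
have := eq_st (rev_ord i); rewrite !mnmE rev_ordK.
by have := partition_ge0 mu i; have := partition_ge0 nu i; lia.
Qed.

Lemma increasing_stair (n : nat) (m : 'X_{1..n}) :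
  increasing m -> exists mu, m = stair mu.
Proof.
move=> m_inc; pose v : {ffun 'I_n -> int} :=
  [ffun i => (m (rev_ord i))%:Z - (rev_ord i : nat)%:Z].
have v_part : decreasing v && [forall i, 0 <= v i].
  apply/andP; split; apply/forallP => i.
    apply/forallP => j; apply/implyP => leij; rewrite !ffunE.
    have le_rev : (rev_ord j <= rev_ord i)%N by rewrite /=; lia.
    by have := increasing_gap m_inc le_rev; lia.
  by rewrite ffunE; have := increasing_ge (rev_ord i) m_inc; lia.
exists (PartitionLe v_part); apply/mnmP => i; rewrite mnmE /= ffunE rev_ordK.
by have := increasing_ge i m_inc; lia.
Qed.

(** * Antisymmetric polynomials *)

Definition antisymmetric_mpoly (n : nat) (R : nzRingType) (p : {mpoly R[n]}) :=
  forall s : 'S_n, msym s p = (-1) ^+ s *: p.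

Lemma antisymmetricP (n : nat) (R : nzRingType) (p : {mpoly R[n]}) :
  antisymmetric_mpoly p ->
  forall (s : 'S_n) (m : 'X_{1..n}),
    p@_[multinom m (s i) | i < n] = (-1) ^+ s * p@_m.
Proof. by move=> p_anti s m; rewrite -mcoeff_sym p_anti mcoeffZ. Qed.

Lemma antisymmetric_mpoly_eq0 (n : nat) (F : fieldType) (p : {mpoly F[n]}) :
  2%:R != 0 :> F -> antisymmetric_mpoly p ->
  (forall mu : partition_le n, p@_(stair mu) = 0) -> p = 0.
Proof.
move=> nz2 /antisymmetricP p_anti p_stair; apply/mpolyP => m; rewrite mcoeff0.
(* Distinct exponents can be sorted into some [stair mu], which changes the coefficient by a sign
   only. *)
have [/injectiveP m_inj|] := boolP (injectiveb m).
  have [s ms_inc] := perm_increasing m_inj.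
  have [|mu def_mu] := @increasing_stair n [multinom m (s i) | i < n].
    by move=> i j ltij; rewrite !mnmE ms_inc.
  apply/eqP; have := p_stair mu; rewrite -def_mu p_anti => /eqP.
  by rewrite mulf_eq0 signr_eq0.
(* Swapping two equal exponents fixes [m] and negates its coefficient, which therefore vanishes
   because 2 is nonzero. *)
case/injectivePn => i [j neq_ij eq_m].
have := p_anti (tperm i j) m; rewrite odd_tperm neq_ij expr1 mulN1r.
have -> : [multinom m (tperm i j k) | k < n] = m.
  by apply/mnmP => k; rewrite mnmE; case: tpermP => // ->.
move/eqP; rewrite -addr_eq0 -mulr2n -mulr_natl mulf_eq0 (negPf nz2) /=.
by move/eqP.
Qed.

(** * Alternants *)

Definition alternant (F : fieldType) (n : nat) (e : 'X_{1..n}) : {mpoly F[n]} :=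
  \det (\matrix_(i < n, j < n) 'X_i ^+ e j).

Lemma alternantE (F : fieldType) (n : nat) (e : 'X_{1..n}) :
  alternant F e =
  \sum_(s : 'S_n) (-1) ^+ s *: 'X_[F, [multinom e (s i) | i < n]].
Proof.
apply: eq_bigr => s _; rewrite mpolyXE_id -signr_odd.
rewrite -[RHS]mul_mpolyC rmorphXn rmorphN1 signr_odd; congr (_ * _).
by apply: eq_bigr => i _; rewrite mxE mnmE.
Qed.

Lemma alternant_antisymmetric (F : fieldType) (n : nat) (e : 'X_{1..n}) :
  antisymmetric_mpoly (alternant F e).
Proof.
move=> s; rewrite /alternant -det_map_mx.
have -> : map_mx (msym s) (\matrix_(i < n, j < n) 'X_i ^+ e j) =
          row_perm s (\matrix_(i < n, j < n) ('X_i ^+ e j : {mpoly F[n]})).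
  by apply/matrixP => i j; rewrite !mxE rmorphXn /= /msym mmapX mmap1U.
by rewrite row_permE det_mulmx det_perm -mul_mpolyC rmorphXn rmorphN1.
Qed.

(** Of all rearrangements of [stair mu], only the one by the identity is increasing, so no other
    term of the determinant can reach [stair nu]. *)
Lemma mcoeff_alternant_stair (F : fieldType) (n : nat) (mu nu : partition_le n) :
  (alternant F (stair mu))@_(stair nu) = (mu == nu)%:R.
Proof.
rewrite alternantE raddf_sum (bigD1 1%g) //= big1 ?addr0 => [|s neq_s1].
  rewrite odd_perm1 scale1r mcoeffX -(inj_eq (@stair_inj n)); congr (_ == _)%:R.
  by apply/mnmP => i; rewrite mnmE perm1.
rewrite mcoeffZ mcoeffX; case: eqP => [/mnmP eq_st|]; last by rewrite mulr0.
case/eqP: neq_s1; apply: (increasing_comp_perm (stair_increasing mu)).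
move=> i j ltij /=; have := eq_st i; have := eq_st j.
by rewrite !mnmE => -> ->; have := stair_increasing nu ltij; rewrite !mnmE.
Qed.

Lemma signr_odd_power (R : pzRingType) (k : nat) (b : bool) :
  ((-1) ^+ b) ^+ k.*2.+1 = (-1) ^+ b :> R.
Proof. by rewrite -exprM mulnC -signr_odd oddM /= odd_double; case: b. Qed.

Lemma antisymmetric_odd_power (n k : nat) (R : comNzRingType)
    (p : {mpoly R[n]}) :
  antisymmetric_mpoly p -> antisymmetric_mpoly (p ^+ k.*2.+1).
Proof.
by move=> p_anti s; rewrite rmorphXn /= p_anti exprZn signr_odd_power.
Qed.

Definition staircase (n : nat) : 'X_{1..n} := [multinom i : nat | i < n].

Lemma alternant_staircase (F : fieldType) (n : nat) :
  alternant F (staircase n) =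
  \prod_(i < n) \prod_(j < n | (i < j)%N) ('X_j - 'X_i).
Proof.
rewrite /alternant -det_tr.
transitivity (\det (Vandermonde n (\row_i ('X_i : {mpoly F[n]})))).
  by congr (\det _); apply/matrixP => i j; rewrite !mxE mnmE.
rewrite det_Vandermonde; apply: eq_bigr => i _; apply: eq_bigr => j _.
by rewrite !mxE.
Qed.

(** The staircase is itself some [stair mu], and its own coefficient in the alternant is 1. *)
Lemma alternant_staircase_neq0 (F : fieldType) (n : nat) :
  alternant F (staircase n) != 0.
Proof.
have [|mu ->] := @increasing_stair n (staircase n).
  by move=> i j; rewrite !mnmE.
apply/eqP => alt0; have := mcoeff_alternant_stair F mu mu.
by rewrite alt0 mcoeff0 eqxx => /esym/eqP; rewrite oner_eq0.
Qed.

(** The two products have factors of opposite sign, a difference that squaring removes. *)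
Lemma vandermonde_even_power (F : fieldType) (n k : nat) :
  vandermonde F n ^+ (2 * k) = alternant F (staircase n) ^+ (2 * k).
Proof.
rewrite !exprM; congr (_ ^+ _); rewrite alternant_staircase -!prodrXl.
apply: eq_bigr => i _; rewrite -!prodrXl; apply: eq_bigr => j _.
by rewrite -sqrrN opprB.
Qed.

(** * Expansions in Schur polynomials *)

Lemma schur_alternant (F : fieldType) (n : nat) (mu : partition_le n) :
  schur F mu =
  tofrac (alternant F (stair mu)) / tofrac (alternant F (staircase n)).
Proof.
have altE e : tofrac (alternant F e) =
    \det (\matrix_(i < n, j < n) tofrac ('X_i : {mpoly F[n]}) ^+ e j).
  rewrite /alternant -(det_map_mx (@tofrac {mpoly F[n]})); congr (\det _).
  by apply/matrixP => i j; rewrite !mxE rmorphXn.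
rewrite /schur !altE; congr (_ / _); congr (\det _); apply/matrixP => i j;
  rewrite !mxE mnmE // exprnP; congr (_ ^ _).
by have := partition_ge0 mu (rev_ord j); lia.
Qed.

(** Clearing the common denominator returns from rational functions to polynomials and raises the
    exponent from 2k to 2k + 1. *)
Lemma schur_expansionE (F : fieldType) (n k : nat)
    (g : {fsfun partition_le n -> F with 0}) :
  schur_expansion (vandermonde F n ^+ (2 * k)) g <->
  alternant F (staircase n) ^+ k.*2.+1 =
    \sum_(mu <- finsupp g) g mu *: alternant F (stair mu).
Proof.
have nz_alt : tofrac (alternant F (staircase n)) != 0.
  by rewrite tofrac_eq0 alternant_staircase_neq0.
rewrite /schur_expansion vandermonde_even_power.
have -> : \sum_(mu <- finsupp g) tofrac ((g mu)%:MP : {mpoly F[n]}) * schur F mu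
   = tofrac (\sum_(mu <- finsupp g) g mu *: alternant F (stair mu))
     / tofrac (alternant F (staircase n)).
  rewrite rmorph_sum mulr_suml; apply: eq_bigr => mu _.
  by rewrite schur_alternant mulrA -tofracM mul_mpolyC.
split=> [eq_frac|eq_alt].
  by apply/eqP; rewrite -tofrac_eq exprSr -mul2n tofracM eq_frac mulfVK.
by rewrite -eq_alt exprSr -mul2n tofracM mulfK.
Qed.

Lemma mcoeff_sum_stair (F : fieldType) (n : nat)
    (g : {fsfun partition_le n -> F with 0}) (nu : partition_le n) :
  (\sum_(mu <- finsupp g) g mu *: alternant F (stair mu))@_(stair nu) = g nu.
Proof.
have summandE mu :
    (g mu *: alternant F (stair mu))@_(stair nu) = g mu * (mu == nu)%:R.
  by rewrite mcoeffZ mcoeff_alternant_stair.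
rewrite raddf_sum (eq_bigr _ (fun mu _ => summandE mu)).
have [g_nu|] := finsuppP g nu.
  rewrite big_seq big1 // => mu g_mu.
  have [eq_mu|] := eqVneq; last by rewrite mulr0.
  by rewrite -eq_mu g_mu in g_nu.
move=> g_nu; rewrite (bigD1_seq nu) ?fset_uniq //= eqxx mulr1 big1 ?addr0 // => mu.
by move/negPf->; rewrite mulr0.
Qed.

Lemma sum_antisymmetric (F : fieldType) (n : nat)
    (g : {fsfun partition_le n -> F with 0}) :
  antisymmetric_mpoly (\sum_(mu <- finsupp g) g mu *: alternant F (stair mu)).
Proof.
move=> s; rewrite raddf_sum /= scaler_sumr; apply: eq_bigr => mu _.
by rewrite msymZ alternant_antisymmetric !scalerA mulrC.
Qed.

(** For the converse, the difference of the two sides is antisymmetric and all its coefficients at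
    exponents [stair mu] vanish. *)
Lemma antisymmetric_expansion (F : fieldType) (n : nat) (p : {mpoly F[n]})
    (g : {fsfun partition_le n -> F with 0}) :
  2%:R != 0 :> F -> antisymmetric_mpoly p ->
  p = \sum_(mu <- finsupp g) g mu *: alternant F (stair mu) <->
  forall mu, g mu = p@_(stair mu).
Proof.
move=> nz2 p_anti; split=> [-> mu|g_p]; first by rewrite mcoeff_sum_stair.
apply/eqP; rewrite -subr_eq0; apply/eqP/(antisymmetric_mpoly_eq0 nz2) => [s|mu].
  by rewrite raddfB /= p_anti sum_antisymmetric scalerBr.
by rewrite mcoeffB mcoeff_sum_stair g_p subrr.
Qed.

Lemma fsfun_of_mcoeff_stair (F : fieldType) (n : nat) (p : {mpoly F[n]}) :
  exists g : {fsfun partition_le n -> F with 0},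
    forall mu, g mu = p@_(stair mu).
Proof.
(* [part] inverts [stair]. On other exponents it may fail to give a partition; [insub] and [pmap]
   discard those, leaving a finite set [S] that contains the support. *)
pose part (m : 'X_{1..n}) : {ffun 'I_n -> int} :=
  [ffun i => (m (rev_ord i))%:Z - (rev_ord i : nat)%:Z].
have partK (mu : partition_le n) : insub (part (stair mu)) = Some mu.
  rewrite -[RHS](valK mu); congr insub; apply/ffunP => i.
  by rewrite ffunE mnmE rev_ordK; have := partition_ge0 mu i; rewrite /=; lia.
pose S : {fset partition_le n} := [fset mu in pmap (insub \o part) (msupp p)]%fset.
exists [fsfun mu in S => p@_(stair mu)] => mu; rewrite fsfunE.
case: ifPn => // mu_notin_S; symmetry; apply: memN_msupp_eq0.
apply: contra mu_notin_S => mu_p; rewrite !inE /= mem_pmap; apply/mapP.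
by exists (stair mu) => //=; rewrite partK.
Qed.

(** * Powers of alternants and the hyperdeterminant *)

Lemma mcoeff_alternant_power (F : fieldType) (n k : nat) (e m : 'X_{1..n}) :
  (alternant F e ^+ k)@_m =
  \sum_(u : {ffun 'I_k -> 'S_n}) (-1) ^+ odd_perm (\prod_(l < k) u l)%g *
    \prod_(i < n) (m i == \sum_(l < k) e (u l i))%N%:R.
Proof.
(* Distributing the power chooses one permutation per factor; the choice [u] yields a signed
   monomial whose exponent is the sum of the permuted copies of [e]. *)
rewrite -[k in LHS]card_ord -prodr_const alternantE bigA_distr_bigA /= raddf_sum.
apply: eq_bigr => u _ /=; rewrite scaler_prod mprodXE mcoeffZ mcoeffX.
congr (_ * _).
  apply: (big_ind2 (fun (x : F) (s : 'S_n) => x = (-1) ^+ s)) => //.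
    by rewrite odd_perm1.
  by move=> _ s _ t -> ->; rewrite odd_permM signr_addb.
have [<-|neq_m] := eqVneq.
  rewrite big1 // => i _; rewrite mnm_sumE.
  by under eq_bigr do rewrite mnmE; rewrite eqxx.
have /existsP[i neq_i] : [exists i, m i != \sum_(l < k) e (u l i)]%N.
  apply: contraR neq_m => /existsPn eq_m; apply/eqP/mnmP => i.
  by rewrite mnm_sumE (eqP (negPn (eq_m i))); apply: eq_bigr => l _; rewrite mnmE.
by rewrite (bigD1 i) //= (negPf neq_i) mul0r.
Qed.

Definition rev_perm (n : nat) : 'S_n := perm (@rev_ord_inj n).

Lemma odd_rev_perm (n : nat) : odd_perm (rev_perm n) = odd 'C(n, 2).
Proof.
elim: n => [|n IHn].
  by rewrite (_ : rev_perm 0 = 1%g) ?odd_perm1 //; apply/permP => -[].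
(* The first point goes to the last; lifting adds [n] to the parity, matching Pascal's rule for
   ['C(n.+1, 2)]. *)
have -> : rev_perm n.+1 = lift_perm ord0 ord_max (rev_perm n).
  apply/permP => i; case: (unliftP ord0 i) => [j|] ->.
    rewrite lift_perm_lift !permE; apply/val_inj => /=.
    by have := ltn_ord j; rewrite /bump /=; lia.
  by rewrite lift_perm_id permE; apply/val_inj => /=; lia.
by rewrite odd_lift_perm IHn binS bin1 oddD addbC.
Qed.

(** A tuple is its head [t] with a tail; for each [t] the tail entries may be reparametrized by
    [h t], a bijection since [T] is finite. *)
Lemma reindex_ffun_ordS (V : nmodType) (T : finType) (m : nat)
    (f : {ffun 'I_m.+1 -> T} -> V) (h : T -> T -> T) :
  (forall t, injective (h t)) ->
  \sum_s f s =
  \sum_t \sum_(u : {ffun 'I_m -> T})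
    f [ffun l => oapp (fun l' => h t (u l')) t (unlift ord0 l)].
Proof.
move=> h_inj; rewrite pair_big /=.
have hV t : {hV | cancel (h t) hV & cancel hV (h t)}.
  by exists (invF (h_inj t)); [apply: invF_f | apply: f_invF].
rewrite (reindex (fun tu : T * {ffun 'I_m -> T} =>
  [ffun l => oapp (fun l' => h tu.1 (tu.2 l')) tu.1 (unlift ord0 l)])) //=.
exists (fun s : {ffun 'I_m.+1 -> T} =>
  (s ord0, [ffun l => s2val (hV (s ord0)) (s (lift ord0 l))])) => [[t u]|s] _ /=.
  rewrite ffunE unlift_none /=; congr pair; apply/ffunP => l.
  by rewrite !ffunE liftK /=; case: (hV t) => /= hVt ->.
apply/ffunP => l; rewrite ffunE; case: unliftP => [l' ->|->] //=.
by rewrite ffunE; case: (hV _) => /= hVt _ ->.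
Qed.

Lemma hyperdet_summand (F : fieldType) (n k : nat) (lambda : partition_le n)
    (t : 'S_n) (u : {ffun 'I_k.*2.+1 -> 'S_n})
    (s := [ffun l : 'I_k.+1.*2 =>
       oapp (fun l' => t * u l' * rev_perm n)%g t (unlift ord0 l)]) :
  (-1) ^+ odd_perm (\prod_(l < k.+1.*2) s l)%g *
    \prod_(i < n) @delta_tensor F n k.+1
      [tuple of part_vec lambda :: nseq k.*2.+1 [ffun => 0]] [ffun l => s l i] =
  (-1) ^+ rev_perm n * ((-1) ^+ odd_perm (\prod_(l < k.*2.+1) u l)%g *
    \prod_(i < n) (stair lambda i ==
       \sum_(l < k.*2.+1) staircase n (u l i))%N%:R).
Proof.
rewrite mulrA; congr (_ * _).
  rewrite big_ord_recl /= /s ffunE unlift_none /=.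
  have signE m (v : 'I_m -> 'S_n) :
      (-1) ^+ odd_perm (\prod_(l < m) v l)%g = \prod_(l < m) (-1) ^+ v l :> F.
    apply: (big_morph (fun w : 'S_n => (-1) ^+ w)) => [w1 w2|].
      by rewrite odd_permM signr_addb.
    by rewrite odd_perm1.
  rewrite odd_permM signr_addb !signE.
  (* The sign of [t] occurs 2k + 2 times in all and cancels; that of the reversal occurs 2k + 1
     times and survives once. *)
  rewrite (eq_bigr (fun l => (-1) ^+ t * (-1) ^+ u l * (-1) ^+ rev_perm n));
    last first.
    by move=> l _; rewrite ffunE liftK !odd_permM !signr_addb.
  rewrite 2!big_split prodr_const prodr_const card_ord !signr_odd_power.
  by rewrite !mulrA -signr_addb addbb expr0 mul1r mulrC.
(* The multi-index at [i] depends on [i] only through [t i], so reindexing by [t] matches the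
   factors one by one. *)
rewrite [RHS](reindex_perm t) /=; apply: eq_bigr => i _.
rewrite /delta_tensor; congr (_ : bool)%:R.
have s0E : [ffun l => s l i] ord0 = t i by rewrite !ffunE unlift_none.
have slE l : [ffun l => s l i] (lift ord0 l) = rev_ord (u l (t i)).
  by rewrite !ffunE liftK /= !permM permE.
have tail0 (l : 'I_k.*2.+1) : tnth [tuple of part_vec lambda ::
    nseq k.*2.+1 [ffun => 0]] (lift ord0 l) = [ffun => 0].
  rewrite (tnth_nth [ffun => 0]) -[LHS]/(nth _ (nseq k.*2.+1 _) l).
  by rewrite nth_nseq if_same.
(* A zero vector contributes only its one-based index, and [(rev_ord x).+1] is [n - x]. *)
rewrite [X in X == _]big_ord_recl (eq_bigr (fun l => (n - u l (t i))%N%:Z));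
  last first.
  move=> l _; rewrite slE tail0 ffunE add0r /=.
  by have := ltn_ord (u l (t i)); lia.
rewrite s0E -[X in _ + X](big_morph Posz PoszD (erefl _)) mnmE.
(* The target (2k + 1)n + 1 absorbs these complements and the head's extra 1, leaving the condition
   on [stair lambda]. *)
have sum_rev : (\sum_(l < k.*2.+1) (n - u l (t i)) + \sum_(l < k.*2.+1) u l (t i))%N =
       (k.*2.+1 * n)%N.
  rewrite -big_split /= (eq_bigr (fun=> n)) ?sum_nat_const ?card_ord // => l _.
  by rewrite subnK // ltnW.
rewrite [in RHS](eq_bigr (fun l => u l (t i) : nat)) => [|l _]; last first.
  by rewrite mnmE.
rewrite (_ : tnth _ _ = part_vec lambda) // doubleS subn1 /= -{}sum_rev.
move: (\sum_(l < _) (n - u l (t i)))%N (\sum_(l < _) u l (t i))%N => a b.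
by have := partition_ge0 lambda (rev_ord (t i)); lia.
Qed.

Lemma hyperdet_deltaE (F : fieldType) (charF : [pchar F] =i pred0)
    (n k : nat) (lambda : partition_le n) :
  hyperdet_delta F (n := n) (p := k.+1)
    [tuple of part_vec lambda :: nseq k.*2.+1 [ffun => 0]] =
  (-1) ^+ 'C(n, 2) * (alternant F (staircase n) ^+ k.*2.+1)@_(stair lambda).
Proof.
rewrite /hyperdet_delta /hyperdet.
rewrite (reindex_ffun_ordS _ (h := fun t v => (t * v * rev_perm n)%g)); last first.
  by move=> t v w /mulIg/mulgI.
rewrite (eq_bigr (fun=> (-1) ^+ 'C(n, 2) *
   (alternant F (staircase n) ^+ k.*2.+1)@_(stair lambda))); last first.
  move=> t _; rewrite mcoeff_alternant_power mulr_sumr; apply: eq_bigr => u _.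
  by rewrite hyperdet_summand odd_rev_perm signr_odd.
rewrite sumr_const card_Sn -[X in _ * X]mulr_natl mulKf //.
by rewrite ((pcharf0P F).1 charF) -lt0n fact_gt0.
Qed.

Theorem corollary4p3 (F : fieldType) (charF : [pchar F] =i pred0)
    (n k : nat) (n_gt0 : (0 < n)%N) (k_gt0 : (0 < k)%N)
    (lambda : partition_le n) :
  (exists! g : {fsfun partition_le n -> F with 0},
     schur_expansion (vandermonde F n ^+ (2 * k)) g) /\
  (forall g : {fsfun partition_le n -> F with 0},
     schur_expansion (vandermonde F n ^+ (2 * k)) g ->
     g lambda =
       (-1) ^+ (n * (n - 1) %/ 2) *
       @hyperdet_delta F n k.+1
         [tuple of part_vec lambda :: nseq k.*2.+1 [ffun => 0]]).
Proof.
set p := alternant F (staircase n) ^+ k.*2.+1.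
(* This pointwise description gives existence, uniqueness and the value at [lambda]. *)
have expansionE g : schur_expansion (vandermonde F n ^+ (2 * k)) g <->
    forall mu, g mu = p@_(stair mu).
  rewrite schur_expansionE; apply: antisymmetric_expansion.
    by rewrite ((pcharf0P F).1 charF).
  exact/antisymmetric_odd_power/alternant_antisymmetric.
split=> [|g /expansionE ->].
  have [g g_p] := fsfun_of_mcoeff_stair p.
  exists g; split=> [|g' /expansionE g'_p]; first exact/expansionE.
  by apply/fsfunP => mu; rewrite g_p g'_p.
(* The sign of the reversal meets the equal sign of the statement, and their product is 1. *)
rewrite hyperdet_deltaE // mulrA bin2 subn1 divn2 -exprD addnn -mul2n.
by rewrite exprM sqrrN !expr1n mul1r.
Qed.
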